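(* Let $X$ be a connected diffeological space, let $g\colon T_2(X)\to\mathbb{R}$ be a weak Riemannian metric on $X$, and let $d\colon X\times X\to\mathbb{R}_{\ge 0}$ be the pseudodistance on $X$ defined by $g$. Then the $D$-topology of $X$ is finer than the topology $\mathcal{O}_d$ defined by $d$; that is, the $D$-topology contains $\mathcal{O}_d$. In particular, $d$ is continuous as a function on $D(X)\times D(X)$, where $D(X)$ is the set $X$ equipped with the $D$-topology and $D(X)\times D(X)$ has the product topology.
   Context: A domain is an open subset of some $\mathbb{R}^n$, $n\ge 0$. A diffeology $\mathcal{D}$ on a set $X$ is a set of maps $P\colon U_P\to X$ from domains (called plots) that contains all constant maps from domains, is closed under precomposition with smooth maps between domains, and is local (a map $U\to X$ from a domain whose restrictions to the members of some open cover of $U$ are plots is a plot). A map between diffeological spaces is smooth if its composite with every plot is a plot. Domains and finite-dimensional manifolds carry the standard diffeology of all usual smooth maps from domains. Tangent construction: regard $\mathcal{D}$ as a category whose objects are plots and whose morphisms $P\to Q$ are smooth maps $h\colon U_P\to U_Q$ with $Q\circ h=P$. Put $T_2(X)=\operatorname{colim}_{P\in\mathcal{D}}\,(U_P\times\mathbb{R}^{\dim U_P}\times\mathbb{R}^{\dim U_P})$ (colimit in diffeological spaces), where $h$ acts by $(r,v,w)\mapsto(h(r),Jh_r v,Jh_r w)$ with $Jh_r$ the Jacobian matrix; $[r,v,w]_P$ denotes the class of $(r,v,w)$. A weak Riemannian metric on $X$ is a map $g\colon T_2(X)\to\mathbb{R}$ such that for every plot $P$ the map $g(P)_r(v,w):=g([r,v,w]_P)$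 is a smooth symmetric covariant $2$-tensor on $U_P$ which is positive, i.e. $g(P)_r(v,v)\ge 0$. Pseudodistance: for $x,y\in X$, $d(x,y)=\inf_\gamma \ell(\gamma)$, with the infimum over smooth $\gamma\colon\mathbb{R}\to X$ with $\gamma(0)=x$, $\gamma(1)=y$, and $\ell(\gamma)=\int_0^1 (g(\gamma)_t(1,1))^{1/2}\,dt$ ($d(x,y)=\infty$ if there is no such $\gamma$). $X$ is connected if any two points are joined by such a smooth path. $\mathcal{O}_d$ is the topology of sets $V$ such that each point of $V$ has some $d$-ball of positive radius contained in $V$. $D$-topology: $O\subset X$ is open iff $P^{-1}(O)$ is open in $U_P$ for every plot $P$. *)

(* Defs.v *)
From HB Require Import structures.
From Stdlib Require Import Relations.
From mathcomp Require Import all_boot all_order all_algebra.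
From mathcomp Require Import generic_quotient.
From mathcomp Require Import all_classical all_reals all_analysis.

Set Implicit Arguments.
Unset Strict Implicit.
Unset Printing Implicit Defensive.

Import Order.TTheory GRing.Theory Num.Theory.
Import numFieldNormedType.Exports.

Local Open Scope classical_set_scope.
Local Open Scope ring_scope.
Local Open Scope quotient_scope.

Fixpoint Ck (R : realType) (V W : normedModType R) (k : nat)
    (U : set V) (f : V -> W) : Prop :=
  if k is k'.+1 then
    (forall x, U x -> differentiable f x) /\
    (forall v, Ck k' U (fun x => 'D_v f x))
  else forall x, U x -> {for x, continuous f}.

Record domain (R : realType) (n : nat) := Domain {
  dset : set 'rV[R]_n;
  dset_open : open dset }.

(* A domain may be empty, and so may the spaces that it is mapped to; hence maps
   are defined on the points of the domain only, not on the whole of 'rV_n. *)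
Definition dpoint (R : realType) (n : nat) (U : domain R n) : Type :=
  {x : 'rV[R]_n | dset U x}.
Coercion dpoint : domain >-> Sortclass.

(* Extension by 0 outside U. As U is open, neither the smoothness on U nor the
   Jacobian at a point of U depends on the values outside U. *)
Definition ext0 (R : realType) (n : nat) (U : domain R n)
    (W : normedModType R) (f : U -> W) (x : 'rV[R]_n) : W :=
  if pselect (dset U x) is left Ux then f (exist _ x Ux) else 0.

Definition smooth_fun (R : realType) (n : nat) (U : domain R n)
    (W : normedModType R) (f : U -> W) : Prop :=
  forall k, Ck k (dset U) (ext0 f).

Definition smooth_map (R : realType) (m n : nat) (U : domain R m)
    (V : domain R n) (h : U -> V) : Prop :=
  smooth_fun (fun x => sval (h x)).

(* mathcomp vectors are rows, so Jh_r v is a right multiplication. *)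
Definition jac (R : realType) (m n : nat) (U : domain R m) (V : domain R n)
    (h : U -> V) (r : U) (v : 'rV[R]_m) : 'rV[R]_n :=
  v *m jacobian (ext0 (fun x => sval (h x))) (sval r).

Definition dincl (R : realType) (n : nat) (W U : domain R n)
    (sWU : dset W `<=` dset U) (x : W) : U :=
  exist _ (sval x) (sWU _ (svalP x)).

Record diffeology (R : realType) (X : Type) := Diffeology {
  plot : forall n (U : domain R n), (U -> X) -> Prop;
  plot_cst : forall n (U : domain R n) (x : X), plot (fun _ : U => x);
  plot_comp : forall m n (U : domain R m) (V : domain R n)
    (h : U -> V) (P : V -> X), smooth_map h -> plot P -> plot (P \o h);
  plot_local : forall n (U : domain R n) (P : U -> X)
    (I : Type) (W : I -> domain R n) (sWU : forall i, dset (W i) `<=` dset U),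
    \bigcup_i dset (W i) = dset U ->
    (forall i, plot (P \o dincl (sWU i))) -> plot P }.

(* The plots of the standard diffeology of U are the smooth maps to U. *)
Definition smooth_from (R : realType) (X : Type) (D : diffeology R X)
    (n : nat) (U : domain R n) (f : U -> X) : Prop :=
  forall m (V : domain R m) (h : V -> U), smooth_map h -> plot D (f \o h).

Definition dspace (R : realType) (X : Type) (D : diffeology R X) : Type := X.

Definition D_open (R : realType) (X : Type) (D : diffeology R X)
    (O : set X) : Prop :=
  forall n (U : domain R n) (P : U -> X), plot D P ->
    open [set x : 'rV[R]_n | exists Ux : dset U x, O (P (exist _ x Ux))].

Section D_topology.
Variables (R : realType) (X : Type) (D : diffeology R X).

Lemma D_openT : D_open D setT.
Proof.
move=> n U P _; have := @dset_open _ _ U; congr open.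
by apply/seteqP; split=> x /= => [Ux|[]//]; exists Ux.
Qed.

Lemma D_openI : setI_closed (D_open D).
Proof.
move=> A B oA oB n U P pP; have := openI (oA n U P pP) (oB n U P pP).
congr open; apply/seteqP; split=> x /=.
  by move=> [[Ux Ax] [Ux' Bx]]; exists Ux; split=> //; rewrite (Prop_irrelevance Ux Ux').
by move=> [Ux [Ax Bx]]; split; exists Ux.
Qed.

Lemma D_open_bigU (I : Type) (f : I -> set X) :
  (forall i, D_open D (f i)) -> D_open D (\bigcup_i f i).
Proof.
move=> of_ n U P pP; have := @bigcup_open _ I setT _ (fun i _ => of_ i n U P pP).
congr open; apply/seteqP; split=> x /=.
  by move=> [i _ [Ux fx]]; exists Ux, i.
by move=> [Ux [i _ fx]]; exists i => //; exists Ux.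
Qed.

HB.instance Definition _ := gen_eqMixin (dspace D).
HB.instance Definition _ := gen_choiceMixin (dspace D).
HB.instance Definition _ :=
  isOpenTopological.Build (dspace D) D_openT D_openI D_open_bigU.

End D_topology.

Record T2pre (R : realType) (X : Type) (D : diffeology R X) := T2Pre {
  t2_dim : nat;
  t2_dom : domain R t2_dim;
  t2_map : t2_dom -> X;
  t2_plot : plot D t2_map;
  t2_pt : t2_dom;
  t2_fst : 'rV[R]_t2_dim;
  t2_snd : 'rV[R]_t2_dim }.

Inductive T2step (R : realType) (X : Type) (D : diffeology R X) :
    T2pre D -> T2pre D -> Prop :=
  T2Step m n (U : domain R m) (V : domain R n) (P : U -> X) (Q : V -> X)
    (pP : plot D P) (pQ : plot D Q) (h : U -> V) (r : U) (v w : 'rV[R]_m) :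
    smooth_map h -> (forall x, Q (h x) = P x) ->
    T2step (T2Pre pP r v w) (T2Pre pQ (h r) (jac h r v) (jac h r w)).

Section T2.
Variables (R : realType) (X : Type) (D : diffeology R X).

HB.instance Definition _ := gen_eqMixin (T2pre D).
HB.instance Definition _ := gen_choiceMixin (T2pre D).

Definition T2equiv (a b : T2pre D) : bool :=
  `[< clos_refl_sym_trans _ (@T2step R X D) a b >].

Lemma T2equiv_refl : reflexive T2equiv.
Proof. by move=> a; apply/asboolP; apply: rst_refl. Qed.

Lemma T2equiv_sym : symmetric T2equiv.
Proof.
by move=> a b; apply/asboolP/asboolP => ab; apply: rst_sym.
Qed.

Lemma T2equiv_trans : transitive T2equiv.
Proof.
move=> b a c /asboolP ab /asboolP bc; apply/asboolP.
exact: rst_trans ab bc.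
Qed.

Canonical T2equiv_equiv := EquivRel T2equiv T2equiv_refl T2equiv_sym T2equiv_trans.

(* The underlying set of the colimit. A colimit of diffeological spaces is the
   colimit of the underlying sets with the quotient diffeology; the latter is
   not needed, since a weak Riemannian metric is a mere map on T_2(X) whose
   regularity is imposed plot by plot. *)
Definition T2 : Type := {eq_quot T2equiv}.

(* [r, v, w]_P *)
Definition T2class (n : nat) (U : domain R n) (P : U -> X) (pP : plot D P)
    (r : U) (v w : 'rV[R]_n) : T2 :=
  \pi_({eq_quot T2equiv}) (T2Pre pP r v w).

End T2.

(* g(P)_r(v, w) *)
Definition metric_at (R : realType) (X : Type) (D : diffeology R X)
    (g : T2 D -> R) (n : nat) (U : domain R n) (P : U -> X) (pP : plot D P)
    (r : U) (v w : 'rV[R]_n) : R :=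
  g (T2class pP r v w).

(* A covariant 2-tensor on U is smooth when its coefficients are. *)
Definition smooth_tensor2 (R : realType) (n : nat) (U : domain R n)
    (b : U -> 'rV[R]_n -> 'rV[R]_n -> R) : Prop :=
  (forall r, bilinear_for *%R *%R (b r)) /\
  (forall i j : 'I_n,
     smooth_fun (fun r : U => b r (delta_mx 0 i) (delta_mx 0 j) : R^o)).

Definition weak_riemannian_metric (R : realType) (X : Type)
    (D : diffeology R X) (g : T2 D -> R) : Prop :=
  forall n (U : domain R n) (P : U -> X) (pP : plot D P),
    [/\ smooth_tensor2 (metric_at g pP),
        forall r v w, metric_at g pP r v w = metric_at g pP r w v &
        forall r v, 0 <= metric_at g pP r v v].

Section smooth_identity.
Variables (R : realType).

Lemma near_eq_differentiable (V W : normedModType R) (f h : V -> W) (x : V) :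
  (\forall y \near x, f y = h y) -> differentiable f x -> differentiable h x.
Proof.
move=> fh /diff_locallyP[cf ef].
have eh : h \o shift x = cst (h x) + 'd f x +o_ (0 : V) id.
  apply/eqaddoP => e e0; move/eqaddoP: ef => /(_ e e0) ef.
  have fh0 : \forall y \near (0 : V), f (y + x) = h (y + x).
    by have := fh; rewrite (near_shift 0) subr0; exact.
  near=> y; rewrite /= -[(h \o _ - _) y]/(h (y + x) - (h x + 'd f x y)).
  rewrite -(nbhs_singleton fh) -(near fh0 y)//.
  by near: y; exact: ef.
have ed := diff_unique cf eh.
by apply/diff_locallyP; rewrite ed.
Unshelve. all: by end_near. Qed.

Lemma Ck_eq (V W : normedModType R) k (U : set V) (f h : V -> W) :
  open U -> (forall x, U x -> f x = h x) -> Ck k U f -> Ck k U h.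
Proof.
move=> oU; have nearU (a b : V -> W) x : U x ->
    (forall x, U x -> a x = b x) -> \forall y \near x, a y = b y.
  move=> Ux ab; have : nbhs x U by exact: open_nbhs_nbhs.
  by apply: filterS => y Uy; exact: ab.
elim: k f h => [|k IH] f h fh /=.
  move=> cf x Ux; rewrite /prop_for /continuous_at -(fh _ Ux).
  by apply: cvg_trans (cf x Ux); apply: near_eq_cvg; exact: nearU.
move=> [df Df]; split=> [x Ux|v].
  by apply: near_eq_differentiable (df _ Ux); exact: nearU.
by apply: IH (Df v) => x Ux; apply: near_eq_derive; exact: nearU.
Qed.

Lemma Ck_cst (V W : normedModType R) k (U : set V) (a : W) :
  open U -> Ck k U (fun _ => a).
Proof.
move=> oU; elim: k a => [|k IH] a /=.
  by move=> x _; exact: cvg_cst.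
split=> [x _|v]; first exact: differentiable_cst.
by apply: Ck_eq (IH 0) => // x _; rewrite derive_cst.
Qed.

Lemma Ck_id (V : normedModType R) k (U : set V) :
  open U -> Ck k U (fun x => x).
Proof.
move=> oU; case: k => [|k] /=; first by move=> x _; exact: cvg_id.
split=> [x _|v]; first exact: ex_diff.
by apply: (Ck_eq oU _ (Ck_cst k v oU)) => x _; rewrite derive_id.
Qed.

Lemma smooth_map_id n (U : domain R n) : smooth_map (fun x : U => x).
Proof.
move=> k; apply: (Ck_eq (@dset_open _ _ U) _ (Ck_id k (@dset_open _ _ U))) => x Ux.
by rewrite /ext0; case: pselect.
Qed.

End smooth_identity.

Lemma smooth_from_plot (R : realType) (X : Type) (D : diffeology R X) (n : nat)
  (U : domain R n) (f : U -> X) : smooth_from D f -> plot D f.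
Proof. by move=> /(_ _ _ _ (@smooth_map_id R n U)). Qed.

Definition line (R : realType) : domain R 1 := Domain (@openT 'rV[R]_1).

Definition line_pt (R : realType) (t : R) : line R :=
  exist _ (const_mx t : 'rV[R]_1) I.

Definition diff_connected (R : realType) (X : Type) (D : diffeology R X) :=
  forall x y : X, exists gamma : line R -> X,
    [/\ smooth_from D gamma, gamma (line_pt 0) = x & gamma (line_pt 1) = y].

Section pseudodistance.
Variables (R : realType) (X : Type) (D : diffeology R X) (g : T2 D -> R).

(* If g is a weak Riemannian metric, then the integrand is continuous. *)
Definition path_length (gamma : line R -> X) (pg : plot D gamma) : R :=
  (\int[lebesgue_measure]_(t in `[0, 1])
     Num.sqrt (metric_at g pg (line_pt t) (const_mx 1) (const_mx 1)))%R.

(* The infimum of the empty set is +oo. *)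
Definition pseudodist (x y : X) : \bar R :=
  ereal_inf [set l | exists (gamma : line R -> X) (sg : smooth_from D gamma),
    [/\ gamma (line_pt 0) = x, gamma (line_pt 1) = y &
        l = (path_length (smooth_from_plot sg))%:E]].

Lemma pseudodist_ge0 x y : (0 <= pseudodist x y)%E.
Proof.
apply: le_ereal_inf_tmp => _ [gamma [sg [_ _ ->]]].
by rewrite lee_fin; apply: Rintegral_ge0 => t _; exact: sqrtr_ge0.
Qed.

Lemma pseudodist_fin_num x y : diff_connected D -> pseudodist x y \is a fin_num.
Proof.
move=> /(_ x y) [gamma [sg gx gy]]; rewrite ge0_fin_numE ?pseudodist_ge0 //.
apply: le_lt_trans (ltry (path_length (smooth_from_plot sg))).
by apply: ereal_inf_lbound; exists gamma, sg.
Qed.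

End pseudodistance.

(* The topology O_d of a pseudodistance, as the family of its open sets. *)
Definition pdist_open (R : realType) (X : Type) (d : X -> X -> \bar R)
    (V : set X) : Prop :=
  forall x, V x -> exists2 e : R, 0 < e & [set y | (d x y < e%:E)%E] `<=` V.

(* Main.v *)
(* The idea is to compare d with Euclidean distance along plots. If P is a plot
   and x0 a point of its domain, then near x0 the form g(P) is bounded by
   K |v|^2, so the segment from x0 to x, run through with a smooth step function
   so as to be defined on all of R inside a ball, is mapped by P to a path of
   length at most sqrt(K) |x - x0|. Hence d(P x0, P x) is small for x near x0,
   which gives the first claim.

   For the continuity of d, the triangle inequality and the symmetry of d are
   needed. Smooth paths can only be glued where they are locally constant, so
   both halves are first reparametrized by a smooth step which is constant
   outside [0, 1]; as it is monotone, lengths are unchanged. *)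
From HB Require Import structures.
From Stdlib Require Import Relations.
Require Import Defs.
From mathcomp Require Import all_boot all_order all_algebra.
From mathcomp Require Import generic_quotient ring lra.
From mathcomp Require Import all_classical all_reals all_analysis.
Import Order.TTheory GRing.Theory Num.Theory.
Import numFieldNormedType.Exports.

Set Implicit Arguments.
Unset Strict Implicit.
Unset Printing Implicit Defensive.

Local Open Scope ring_scope.
Local Open Scope classical_set_scope.

(** * Smooth functions of one real variable *)

Section real_smooth.
Variable R : realType.
Implicit Types f g : R -> R.

(** One-variable counterpart of [Ck]. With a single derivative to iterate, closure under sums,
    products, inverses and composition follows by induction from the differentiation rules;
    [Ck_curve] makes the link to [Ck]. *)
Fixpoint derivable_n (n : nat) f : Prop :=
  if n is n'.+1 then
    (forall x : R, derivable f x 1) /\ derivable_n n' (derive1 f)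
  else True.

Definition smooth1 f := forall n, derivable_n n f.

Lemma derive1_is_derive f f' : (forall x : R, is_derive x 1 f (f' x)) -> derive1 f = f'.
Proof. by move=> df; apply/funext => x; rewrite derive1E derive_val. Qed.

Lemma is_derive_derivable_n n f f' : (forall x : R, is_derive x 1 f (f' x)) ->
  derivable_n n f' -> derivable_n n.+1 f.
Proof.
move=> df nf' /=; rewrite (derive1_is_derive df).
by split=> // x; exact: (@ex_derive _ _ _ f x 1 (f' x)).
Qed.

Lemma derivable_n_is_derive n f : derivable_n n.+1 f ->
  forall x : R, is_derive x 1 f (derive1 f x).
Proof. by move=> [df _] x; rewrite derive1E; exact: derivableP. Qed.

Lemma derivable_nS n f : derivable_n n.+1 f -> derivable_n n f.
Proof. by elim: n f => [//|n IH] f [df /IH nf]; split. Qed.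

Lemma derivable_n_cst n (a : R) : derivable_n n (cst a).
Proof.
elim: n a => [//|n IH] a.
exact: is_derive_derivable_n (fun x : R => is_derive_cst a x (1 : R)) (IH 0).
Qed.

Lemma derivable_nD n f g :
  derivable_n n f -> derivable_n n g -> derivable_n n (f + g).
Proof.
elim: n f g => [//|n IH] f g nf ng.
apply: (@is_derive_derivable_n _ _ (derive1 f + derive1 g)); last first.
  by apply: IH; [case: nf | case: ng].
move=> x; have ? := derivable_n_is_derive nf x.
by have ? := derivable_n_is_derive ng x; exact: is_deriveD.
Qed.

Lemma derivable_nM n f g :
  derivable_n n f -> derivable_n n g -> derivable_n n (f * g).
Proof.
elim: n f g => [//|n IH] f g nf ng.
apply: (@is_derive_derivable_n _ _ (f * derive1 g + g * derive1 f)); last first.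
  apply: derivable_nD; apply: IH; first exact: derivable_nS.
  - by case: ng.
  - exact: derivable_nS.
  - by case: nf.
move=> x; have ? := derivable_n_is_derive nf x.
by have ? := derivable_n_is_derive ng x; exact: is_deriveM.
Qed.

(** Up to sign, the derivative of the inverse is [derive1 f] times two copies of the inverse itself,
    so the induction hypothesis covers it one order lower. *)
Lemma derivable_nV n f : (forall x, f x != 0) ->
  derivable_n n f -> derivable_n n (fun x => (f x)^-1).
Proof.
move=> f0; elim: n => [//|n IH] nf.
pose i x := (f x)^-1.
apply: (@is_derive_derivable_n _ _ (cst (-1) * (i * i * derive1 f))).
  move=> x; have D := is_deriveV (f0 x) (derivable_n_is_derive nf x).
  apply: is_derive_eq D _.
  rewrite /cst /i/= /GRing.scale/= !fctE; field; exact: f0.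
have ni := IH (derivable_nS nf).
apply: derivable_nM; first exact: derivable_n_cst.
by apply: derivable_nM; [exact: derivable_nM | case: nf].
Qed.

Lemma derivable_n_comp n f g :
  derivable_n n f -> derivable_n n g -> derivable_n n (f \o g).
Proof.
elim: n f g => [//|n IH] f g nf ng.
apply: (@is_derive_derivable_n _ _ (derive1 g * (derive1 f \o g))).
  move=> x; have dg := derivable_n_is_derive ng x.
  have D := is_derive1_comp (derivable_n_is_derive nf (g x)) dg.
  by apply: is_derive_eq D _; rewrite mulrC.
apply: derivable_nM; first by case: ng.
by apply: IH; [case: nf | exact: derivable_nS].
Qed.

Lemma derivable_n_id n : derivable_n n (@id R).
Proof.
case: n => [//|n].
exact: is_derive_derivable_n (fun x : R => is_derive_id x (1 : R)) (derivable_n_cst n 1).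
Qed.

Lemma smooth1_is_derive f (x : R) : smooth1 f -> is_derive x 1 f (derive1 f x).
Proof. by move=> sf; exact: (@derivable_n_is_derive 0). Qed.

Lemma smooth1_derive1 f : smooth1 f -> smooth1 (derive1 f).
Proof. by move=> sf n; case: (sf n.+1). Qed.

Lemma smooth1_continuous f : smooth1 f -> continuous f.
Proof.
move=> sf x; have [df _] := sf 1%N.
exact/differentiable_continuous/derivable1_diffP/df.
Qed.

Lemma smooth1_affine (a b : R) : smooth1 (fun t => a * t + b).
Proof.
move=> n; apply: derivable_nD; last exact: derivable_n_cst.
by apply: derivable_nM; [exact: derivable_n_cst | exact: derivable_n_id].
Qed.

Lemma smooth1_comp f g : smooth1 f -> smooth1 g -> smooth1 (f \o g).
Proof. by move=> sf sg n; exact: derivable_n_comp. Qed.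

Lemma derive1_comp_affine f (a b t : R) : smooth1 f ->
  derive1 (fun t => f (a * t + b)) t = a * derive1 f (a * t + b).
Proof.
move=> sf; rewrite derive1E; apply: derive_val.
have df := smooth1_is_derive (a * t + b) sf.
have da : is_derive t 1 (fun t => a * t + b) a.
  have := is_deriveD (is_deriveZ a (is_derive_id t (1 : R))) (is_derive_cst b t (1 : R)).
  by rewrite addr0 /GRing.scale/= mulr1.
by have := @is_derive1_comp _ f (fun t => a * t + b) _ _ _ df da; rewrite mulrC.
Qed.

Lemma derive1_1B f t : smooth1 f -> derive1 (fun t => 1 - f t) t = - derive1 f t.
Proof.
move=> sf; rewrite derive1E -sub0r.
have D := is_deriveB (is_derive_cst (1 : R) t (1 : R)) (smooth1_is_derive t sf).
exact: (@derive_val _ _ _ _ _ _ _ D).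
Qed.

Lemma smooth1_1B f : smooth1 f -> smooth1 (fun t => 1 - f t).
Proof.
move=> sf; rewrite (_ : (fun t => _) = (fun t => -1 * t + 1) \o f).
  exact: smooth1_comp (smooth1_affine _ _) sf.
by apply/funext => t /=; rewrite mulN1r addrC.
Qed.

(** * A monotone smooth step *)

(** For [k = 0] this is the classical function that is flat at 0. The powers of [t^-1] make the
    family closed under differentiation up to linear combinations, so that one induction proves all
    members smooth. *)
Definition flat (k : nat) (t : R) : R :=
  if 0 < t then t^-1 ^+ k * expR (- t^-1) else 0.

Lemma flat_ge0 k t : 0 <= flat k t.
Proof.
rewrite /flat; case: ifP => // t0.
by rewrite mulr_ge0 ?expR_ge0 // exprn_ge0 ?invr_ge0 // ltW.
Qed.

(** The term of degree [k.+2] of the exponential series bounds [expR t^-1] from below. The estimate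
    serves to show that these functions are continuous at 0. *)
Lemma flat_le k t : flat k t <= k.+2`!%:R * t ^+ 2.
Proof.
have [t0|t0] := ltP 0 t; last by rewrite /flat ltNge t0/= mulr_ge0 ?sqr_ge0.
rewrite /flat t0 expRN ler_pdivrMr ?expR_gt0 //.
have t1 : 0 <= t^-1 by rewrite invr_ge0 ltW.
have := expR_ge1Dxn k.+1 t1.
have fk : 0 < k.+2`!%:R :> R by rewrite ltr0n fact_gt0.
move=> H; have {}H : t^-1 ^+ k.+2 / k.+2`!%:R <= expR t^-1.
  by apply: le_trans H; rewrite lerDr.
have c0 : 0 <= k.+2`!%:R * t ^+ 2 by rewrite mulr_ge0 ?sqr_ge0 // ltW.
apply: le_trans (ler_wpM2l c0 H).
have tn : t != 0 by rewrite gt_eqF.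
rewrite !exprS le_eqVlt; apply/orP; left; apply/eqP.
by field; rewrite tn gt_eqF.
Qed.

Lemma flat_is_derive k (t : R) :
  is_derive t 1 (flat k) (flat k.+2 t - k%:R * flat k.+1 t).
Proof.
have [t0|t0|<-] := ltgtP 0 t.
- have tn : t != 0 by rewrite gt_eqF.
  have E : \forall y \near t,
      ((@GRing.inv R) ^+ k * (@expR R \o (fun y => - y^-1))) y = flat k y.
    by near=> y; rewrite /flat ifT//; [rewrite !fctE | near: y; exact: lt_nbhsr].
  apply: near_eq_is_derive E _.
  have dV := @is_deriveV _ id t _ _ tn (is_derive_id t 1).
  have dE := @is_derive1_comp _ expR (fun y => - y^-1) _ _ _
    (is_derive_expR (- t^-1)) (is_deriveN dV).
  apply: is_derive_eq (is_deriveM (is_deriveX k dV) dE) _.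
  rewrite /flat t0 /GRing.scale/= mulr1.
  by case: {+}k => [|k0]; rewrite ?fctE /= ?exprS; field.
- have E : \forall y \near t, cst 0 y = flat k y.
    near=> y; rewrite /flat ifF//; apply/negbTE; rewrite -leNgt ltW//.
    by near: y; exact: lt_nbhsl.
  apply: near_eq_is_derive E _.
  apply: is_derive_eq (is_derive_cst _ _ _) _.
  by rewrite /flat !ifF ?mulr0 ?subr0//; apply/negbTE; rewrite -leNgt ltW.
(* At 0 the difference quotient of [flat k] is [flat k.+1], whose continuity there is squeezed out
   of [flat_le]. *)
- apply/is_derive1_caratheodory; exists (flat k.+1).
  have f0 n : flat n 0 = 0 by rewrite /flat ltxx.
  split; last by rewrite !f0 mulr0 subr0.
    move=> z; rewrite f0 !subr0 /flat; case: ifP => [z0|]; last by rewrite mul0r.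
    by rewrite exprS; field; rewrite gt_eqF.
  rewrite /prop_for /continuous_at f0.
  have c0 : (k.+3`!%:R * z ^+ 2) @[z --> (0 : R)] --> (0 : R).
    have : (k.+3`!%:R * z ^+ 2) @[z --> (0 : R)] --> (k.+3`!%:R * 0 ^+ 2 : R).
      by apply: cvgM; [exact: cvg_cst | exact: exprn_continuous].
    by rewrite expr0n mulr0.
  apply: (squeeze_cvgr _ (cvg_cst 0) c0).
  by apply: nearW => z; rewrite flat_ge0 flat_le.
Unshelve. all: by end_near. Qed.

Lemma flat_smooth k : smooth1 (flat k).
Proof.
move=> n; elim: n k => [//|n IH] k.
apply: is_derive_derivable_n (flat_is_derive k) _.
rewrite (_ : (fun t => _) = flat k.+2 + cst (- k%:R) * flat k.+1); last first.
  by apply/funext => t; rewrite !fctE mulNr.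
apply: derivable_nD => //.
by apply: derivable_nM => //; exact: derivable_n_cst.
Qed.

Definition smooth_step (t : R) : R := flat 0 t / (flat 0 t + flat 0 (1 - t)).

Lemma flat0_gt0 (t : R) : 0 < t -> 0 < flat 0 t.
Proof. by move=> t0; rewrite /flat t0 mul1r expR_gt0. Qed.

Lemma flat_le0 k (t : R) : t <= 0 -> flat k t = 0.
Proof. by move=> t0; rewrite /flat ltNge t0. Qed.

(** [t] and [1 - t] are never both nonpositive, so one term is positive while the other is
    nonnegative. *)
Lemma smooth_step_den t : 0 < flat 0 t + flat 0 (1 - t).
Proof.
have [t0|t0] := ltP 0 t; first by rewrite ltr_wpDr ?flat_ge0 ?flat0_gt0.
by rewrite ltr_wpDl ?flat_ge0 ?flat0_gt0 // subr_gt0 (le_lt_trans t0).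
Qed.

Lemma smooth_step_le0 t : t <= 0 -> smooth_step t = 0.
Proof. by move=> t0; rewrite /smooth_step flat_le0 // mul0r. Qed.

Lemma smooth_step_ge1 t : 1 <= t -> smooth_step t = 1.
Proof.
move=> t1; rewrite /smooth_step (@flat_le0 _ (1 - t)) ?subr_le0 // addr0 divff //.
by rewrite gt_eqF ?flat0_gt0 // (lt_le_trans _ t1).
Qed.

Lemma smooth_step_ge0 t : 0 <= smooth_step t.
Proof. by rewrite divr_ge0 ?flat_ge0 // ltW ?smooth_step_den. Qed.

Lemma smooth_step_le1 t : smooth_step t <= 1.
Proof. by rewrite ler_pdivrMr ?smooth_step_den // mul1r lerDl flat_ge0. Qed.

Lemma flat_onem_smooth k : smooth1 (fun t => flat k (1 - t)).
Proof.
exact: smooth1_comp (@flat_smooth k) (smooth1_1B (@derivable_n_id)).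
Qed.

Lemma smooth_step_smooth : smooth1 smooth_step.
Proof.
move=> n.
apply: (@derivable_nM _ (flat 0) (fun t => (flat 0 t + flat 0 (1 - t))^-1)).
  exact: flat_smooth.
apply: derivable_nV; first by move=> x; rewrite gt_eqF ?smooth_step_den.
by apply: derivable_nD; [exact: flat_smooth | exact: flat_onem_smooth].
Qed.

(** In the quotient rule the terms in [f * f'] cancel, and the numerator left is a sum of products
    of values of [flat]. Thanks to this sign, absolute values disappear from the speeds of
    reparametrized paths. *)
Lemma derive1_smooth_step_ge0 t : 0 <= derive1 smooth_step t.
Proof.
pose f := flat 0; pose h t := flat 0 (1 - t).
have df : is_derive t 1 f (flat 2 t).
  by apply: is_derive_eq (flat_is_derive 0 t) _; rewrite mul0r subr0.
have dh : is_derive t 1 h (- flat 2 (1 - t)).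
  rewrite (_ : h = (fun t => f (-1 * t + 1))); last first.
    by apply/funext => x; rewrite mulN1r addrC.
  have := smooth1_is_derive t (smooth1_comp (@flat_smooth 0) (smooth1_affine (-1) 1)).
  rewrite (derive1_comp_affine _ _ _ (@flat_smooth 0)).
  rewrite (derive1_is_derive (flat_is_derive 0)).
  by rewrite !mul0r subr0 mulN1r addrC mulN1r.
have d0 : (f + h) t != 0 by rewrite gt_eqF ?smooth_step_den.
have D := is_deriveM df (is_deriveV d0 (is_deriveD df dh)).
rewrite derive1E (_ : smooth_step = f * (fun y => ((f + h) y)^-1)) //.
rewrite (@derive_val _ _ _ _ _ _ _ D) /GRing.scale/= !fctE.
have den := smooth_step_den t; rewrite -/(f t) -/(h t) in den.
rewrite [leRHS](_ : _ = (flat 2 t * h t + flat 2 (1 - t) * f t) / (f t + h t) ^+ 2).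
  by rewrite divr_ge0 ?sqr_ge0 // addr_ge0 // mulr_ge0 // flat_ge0.
by field; rewrite gt_eqF.
Qed.

(** * Integrals over segments and change of variables *)

Notation mu := (@lebesgue_measure R).

Lemma continuous_integrable_segment (h : R -> R) (a b : R) :
  continuous h -> mu.-integrable `[a, b] (EFin \o h).
Proof.
move=> ch; apply: continuous_compact_integrable; first exact: segment_compact.
exact: continuous_subspaceT.
Qed.

Lemma derive1_smooth_step0 t : t < 0 -> derive1 smooth_step t = 0.
Proof.
move=> t0; rewrite derive1E -(@derive_cst _ _ _ (0 : R) t 1); apply: near_eq_derive.
by near=> y; rewrite smooth_step_le0 // ltW //; near: y; exact: lt_nbhsl.
Unshelve. all: by end_near. Qed.

Lemma derive1_smooth_step1 t : 1 < t -> derive1 smooth_step t = 0.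
Proof.
move=> t1; rewrite derive1E -(@derive_cst _ _ _ (1 : R) t 1); apply: near_eq_derive.
by near=> y; rewrite smooth_step_ge1 // ltW //; near: y; exact: lt_nbhsr.
Unshelve. all: by end_near. Qed.

(** The primitive [F] is fixed before [s], so integrals along different reparametrizations are
    compared through the values of [F] at their endpoints. Monotonicity of [s] does not enter, as
    the derivative is taken with its sign. *)
Lemma integral_substitution f : continuous f ->
  exists2 F : R -> R, F 1 - F 0 = \int[mu]_(t in `[0, 1]) f t &
  forall s : R -> R, smooth1 s -> (forall t, 0 <= s t <= 1) ->
    \int[mu]_(t in `[0, 1]) (f (s t) * derive1 s t) = F (s 1) - F (s 0).
Proof.
move=> cf.
(* Starting from -1 makes the endpoints 0 and 1 interior points. *)
pose F (x : R) : R := \int[mu]_(t in `[-1, x]) f t.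
have dF (x : R) : 0 <= x <= 1 -> is_derive x 1 F (f x).
  move=> /andP[x0 x1].
  have [||d <-] := @continuous_FTC1_closed R f (-1) x 2 _
    (continuous_integrable_segment _ _ cf) _ (cf x).
  - by rewrite (le_lt_trans x1) // ltr1n.
  - by rewrite (lt_le_trans _ x0) // ltrN10.
  by rewrite derive1E; exact: derivableP.
(* The bound on [s] is asked on [0, 1] only, which admits the identity; that instance evaluates
   [F 1 - F 0]. *)
have FTC (s : R -> R) : smooth1 s -> {in `[0, 1]%R, forall t, 0 <= s t <= 1} ->
    \int[mu]_(t in `[0, 1]) (f (s t) * derive1 s t) = F (s 1) - F (s 0).
  move=> ss s01.
  have dFs (t : R) : t \in `[0, 1]%R -> is_derive t 1 (F \o s) (f (s t) * derive1 s t).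
    by move=> t01; apply: is_derive1_comp; [exact/dF/s01 | exact: smooth1_is_derive].
  have cFs (t : R) : t \in `[0, 1]%R -> {for t, continuous (F \o s)}.
    move=> /dFs dt; apply/differentiable_continuous/derivable1_diffP.
    exact: ex_derive.
  have cint : continuous (fun t => f (s t) * (derive1 s) t).
    move=> t; apply: continuousM; last exact/smooth1_continuous/smooth1_derive1.
    by apply: (@continuous_comp _ _ _ s f); [exact: smooth1_continuous | exact: cf].
  rewrite /Rintegral (@continuous_FTC2 _ _ (F \o s)) //.
  - exact: continuous_subspaceT.
  - split.
    + move=> t /subset_itv_oo_cc t01; have ? := dFs t t01; exact: ex_derive.
    + by apply: cvg_at_right_filter; apply: cFs; rewrite in_itv/= lexx ler01.
    + by apply: cvg_at_left_filter; apply: cFs; rewrite in_itv/= lexx ler01.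
  - move=> t /subset_itv_oo_cc t01; rewrite derive1E.
    exact: (@derive_val _ _ _ _ _ _ _ (dFs t t01)).
exists F; last by move=> s ss s01; apply: FTC => // t _; exact: s01.
have := FTC id (@derivable_n_id) (fun t t01 => t01).
rewrite (derive1_is_derive (fun x : R => is_derive_id x (1 : R))) => <-.
by apply: eq_Rintegral => t _; rewrite mulr1.
Qed.

End real_smooth.

(** * Points of domains and smooth curves in them *)

Lemma dpoint_inj (R : realType) n (U : domain R n) (x y : U) :
  sval x = sval y -> x = y.
Proof.
by case: x y => x Ux [y Uy] /= xy; subst y; rewrite (Prop_irrelevance Ux Uy).
Qed.

Lemma dpoint_nbhs (R : realType) n (U : domain R n) (x : U) : nbhs (sval x) (dset U).
Proof. by apply: open_nbhs_nbhs; split; [exact: dset_open | exact: svalP]. Qed.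

Section smooth_curves.
Variable R : realType.

Lemma coord_linear m n i j : linear (fun M : 'M[R]_(m, n) => M i j : R^o).
Proof. by move=> a M N; rewrite !mxE. Qed.

Lemma diff_coord m n i j (M : 'M[R]_(m, n)) :
  'd (fun N : 'M[R]_(m, n) => N i j : R^o) M = (fun N => N i j) :> (_ -> _).
Proof.
pose lin := GRing.isLinear.Build _ _ _ _ _ (@coord_linear m n i j).
pose f : {linear 'M[R]_(m, n) -> R^o} :=
  HB.pack (fun N : 'M[R]_(m, n) => N i j : R^o) lin.
by rewrite -[RHS]/(f : _ -> _) -(@diff_lin _ _ _ f M (@coord_continuous _ _ _ i j)).
Qed.

(** A line run through at the pace [s]. Directional derivatives keep this shape, which drives the
    induction in [Ck_curve]. The form covers segments in a domain and, for [n = 1], changes of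
    parameter of a path. *)
Definition curve n (a u : 'rV[R]_n) (s : R -> R) (x : 'rV[R]_1) : 'rV[R]_n :=
  a + s (x 0 0) *: u.

Section curve.
Variables (n : nat) (a u : 'rV[R]_n) (s : R -> R) (ss : smooth1 s).

Let ds t : differentiable s t.
Proof. by apply/derivable1_diffP; have [] := ss 1%N. Qed.

Let dsc (x : 'rV[R]_1) : differentiable (fun x : 'rV[R]_1 => s (x 0 0) : R^o) x.
Proof. by apply: (differentiable_comp (differentiable_coord _ _ _) (ds _)). Qed.

Lemma differentiable_curve x : differentiable (curve a u s) x.
Proof. by apply: differentiableD => //; exact: differentiableZl. Qed.

Lemma derive_curve x v : 'D_v (curve a u s) x = curve 0 (v 0 0 *: u) (derive1 s) x.
Proof.
pose c (x : 'rV[R]_1) : R^o := s (x 0 0).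
have dc : 'd c x v = v 0 0 * derive1 s (x 0 0).
  have := diff_comp (differentiable_coord x 0 0) (ds (x 0 0)).
  move=> /(congr1 (fun f => f v)); rewrite /= diff1E// diff_coord; exact.
have dz := @diffZl _ _ _ c u x (dsc x).
rewrite /curve deriveD; [|exact: derivable_cst | exact/diff_derivable/differentiableZl].
rewrite derive_cst add0r deriveE; last exact: differentiableZl.
by rewrite dz dc add0r scalerA [in RHS]mulrC.
Qed.

End curve.

Lemma Ck_curve n k W (a u : 'rV[R]_n) s : smooth1 s -> open W -> Ck k W (curve a u s).
Proof.
move=> + oW; elim: k a u s => [|k IH] a u s ss /=.
  by move=> x _; apply: differentiable_continuous; exact: differentiable_curve.
split=> [x _|v]; first exact: differentiable_curve.
rewrite (_ : (fun x => _) = curve 0 (v 0 0 *: u) (derive1 s)).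
  exact/IH/smooth1_derive1.
by apply/funext => x; rewrite derive_curve.
Qed.

Section smooth_map_ext.
Variables (m n : nat) (U : domain R m) (V : domain R n) (h : U -> V).
Variable (f : 'rV[R]_m -> 'rV[R]_n).
Hypothesis hf : forall x : U, sval (h x) = f (sval x).

Lemma ext0_eq x : dset U x -> f x = ext0 (fun x => sval (h x)) x.
Proof. by move=> Ux; rewrite /ext0; case: pselect => // {}Ux; rewrite hf. Qed.

Lemma smooth_map_ext : (forall k, Ck k (dset U) f) -> smooth_map h.
Proof. by move=> cf k; apply: Ck_eq (cf k); [exact: dset_open | exact: ext0_eq]. Qed.

(** As [U] is open, [f] and the extension of [h] by 0 agree near [r], hence have the same derivative
    there. *)
Lemma jac_ext (r : U) v : differentiable f (sval r) -> jac h r v = 'D_v f (sval r).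
Proof.
move=> df; rewrite /jac.
have nfh : \forall y \near sval r, f y = ext0 (fun x => sval (h x)) y.
  have := dpoint_nbhs r.
  by apply: filterS => y /ext0_eq.
rewrite -deriveEjacobian; last exact: near_eq_differentiable nfh df.
by apply/esym/near_eq_derive.
Qed.

End smooth_map_ext.

Lemma smooth_map_dincl n (W U : domain R n) (sWU : dset W `<=` dset U) :
  smooth_map (dincl sWU).
Proof.
by apply: (@smooth_map_ext _ _ _ _ _ id) => // k; apply: Ck_id; exact: dset_open.
Qed.

Lemma jac_dincl n (W U : domain R n) (sWU : dset W `<=` dset U) r v :
  jac (dincl sWU) r v = v.
Proof. by rewrite (@jac_ext _ _ _ _ _ id) // derive_id. Qed.

End smooth_curves.

(** * Coordinates and pullbacks of the metric *)

Section linear_for.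
Variables (R : realType) (n : nat) (f : 'rV[R]_n -> R).
Hypothesis lf : GRing.linear_for *%R f.

Let F : {linear 'rV[R]_n -> R | *%R} := HB.pack f (GRing.isLinear.Build _ _ _ _ _ lf).

Lemma linear_for_scale a v : f (a *: v) = a * f v.
Proof. exact: (linearZ_LR F). Qed.

Lemma linear_for_row v : f v = \sum_i v 0 i * f (delta_mx 0 i).
Proof.
rewrite [in LHS](row_sum_delta v) -[f]/(F : _ -> _) linear_sum.
by apply: eq_bigr => i _; exact: linear_for_scale.
Qed.

End linear_for.

Section metric.
Variables (R : realType) (X : Type) (D : diffeology R X) (g : T2 D -> R).

(** The two triples are one generating step apart in the colimit, so they are the same point of
    T_2(X) and [g] cannot tell them apart. *)
Lemma metric_pull m n (U : domain R m) (V : domain R n) (P : U -> X) (Q : V -> X)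
    (pP : plot D P) (pQ : plot D Q) (h : U -> V) r v w :
  smooth_map h -> (forall x, Q (h x) = P x) ->
  metric_at g pP r v w = metric_at g pQ (h r) (jac h r v) (jac h r w).
Proof.
move=> sh hPQ; rewrite /metric_at /T2class; congr g.
by apply/eqmodP/asboolP/rst_step; exact: T2Step.
Qed.

Hypothesis hg : weak_riemannian_metric g.

Lemma metric_scale n (U : domain R n) (P : U -> X) (pP : plot D P) r (a : R) v :
  metric_at g pP r (a *: v) (a *: v) = a ^+ 2 * metric_at g pP r v v.
Proof.
have [[bil _] _ _] := hg pP; have [l1 l2] := bil r.
by rewrite (linear_for_scale (l1 _)) (linear_for_scale (l2 _)) mulrA -expr2.
Qed.

Lemma metric_coord n (U : domain R n) (P : U -> X) (pP : plot D P) r v :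
  metric_at g pP r v v = \sum_i \sum_j v 0 i * (v 0 j *
    metric_at g pP r (delta_mx 0 i) (delta_mx 0 j)).
Proof.
have [[bil _] _ _] := hg pP; have [l1 l2] := bil r.
rewrite [LHS](linear_for_row (l1 v)); apply: eq_bigr => i _.
by rewrite (linear_for_row (l2 _)) mulr_sumr.
Qed.

(* The curve needs to describe gamma on W only: glued paths follow different
   curves on different open sets. *)
Lemma metric_curve n (V : domain R n) (Q : V -> X) (pQ : plot D Q)
    (gamma : line R -> X) (pg : plot D gamma) (W : domain R 1)
    (a u : 'rV[R]_n) (s : R -> R) (cV : forall x, dset W x -> dset V (curve a u s x)) :
  smooth1 s ->
  (forall (x : 'rV[R]_1) (Wx : dset W x),
     gamma (exist _ x I) = Q (exist _ (curve a u s x) (cV x Wx))) ->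
  forall (t : R) (Wt : dset W (const_mx t)),
  metric_at g pg (line_pt t) (const_mx 1) (const_mx 1) =
  (derive1 s t) ^+ 2 * metric_at g pQ (exist _ _ (cV _ Wt)) u u.
Proof.
move=> ss gQ t Wt.
have sWl : dset W `<=` dset (line R) by [].
have pW : plot D (gamma \o dincl sWl) by apply: plot_comp => //; exact: smooth_map_dincl.
pose h : W -> V := fun x => exist _ _ (cV _ (svalP x)).
pose r : W := exist _ _ Wt.
have sh : smooth_map h.
  apply: (@smooth_map_ext _ _ _ _ _ _ (curve a u s)) => // k.
  by apply: Ck_curve => //; exact: dset_open.
have jh : jac h r (const_mx 1) = derive1 s t *: u.
  rewrite (@jac_ext _ _ _ _ _ _ (curve a u s)) //; last exact: differentiable_curve.
  by rewrite derive_curve // /curve add0r !mxE scale1r.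
(* The restriction of [gamma] to [W] is a pullback in two ways: of [gamma] along the inclusion, and
   of [Q] along the curve. Equating the two values gives the claim. *)
have E1 := metric_pull pW pg r (const_mx 1) (const_mx 1)
  (smooth_map_dincl sWl) (fun=> erefl).
have E2 := metric_pull pW pQ r (const_mx 1) (const_mx 1) sh _.
rewrite !jac_dincl in E1.
transitivity (metric_at g pW r (const_mx 1) (const_mx 1)).
  by rewrite E1 (_ : line_pt t = dincl sWl r) //; exact: dpoint_inj.
rewrite E2.
  by rewrite jh metric_scale; congr (_ * metric_at g pQ _ u u); exact: dpoint_inj.
by move=> [x Wx]; rewrite /h/= -gQ; congr gamma; exact: dpoint_inj.
Qed.

End metric.

(** * Speed and length of paths, and short paths in plots *)

Section pseudodistance.
Variables (R : realType) (X : Type) (D : diffeology R X) (g : T2 D -> R).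
Hypothesis hg : weak_riemannian_metric g.
Notation mu := (@lebesgue_measure R).

Definition speed (gamma : line R -> X) (pg : plot D gamma) (t : R) : R :=
  Num.sqrt (metric_at g pg (line_pt t) (const_mx 1) (const_mx 1)).

Lemma const_mx_continuous : continuous (fun t : R => const_mx t : 'rV[R]_1).
Proof.
move=> t; rewrite (_ : (fun t => _) = (fun t : R => t *: (const_mx 1 : 'rV[R]_1))).
  exact: scalel_continuous.
by apply/funext => x; apply/matrixP => i j; rewrite !mxE mulr1.
Qed.

Lemma ext0E n (U : domain R n) (W : normedModType R) (f : U -> W) (x : U) :
  ext0 f (sval x) = f x.
Proof.
by rewrite /ext0; case: pselect => [Ux|/(_ (svalP x))//]; congr f; exact: dpoint_inj.
Qed.

(** In dimension 1 the only coefficient of the tensor is its value on [const_mx 1], and smoothness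
    at order 0 is continuity. *)
Lemma speed_continuous (gamma : line R -> X) (pg : plot D gamma) : continuous (speed pg).
Proof.
have d1 : delta_mx 0 0 = const_mx 1 :> 'rV[R]_1.
  by apply/matrixP => i j; rewrite !mxE !ord1.
have [[_ /(_ 0 0 0%N) cg] _ _] := hg pg; rewrite d1 in cg.
move=> t; rewrite /speed.
apply: (@continuous_comp _ _ _
  (fun t => metric_at g pg (line_pt t) (const_mx 1) (const_mx 1)) Num.sqrt);
  last exact: sqrt_continuous.
rewrite (_ : (fun t => _) =
    ext0 (fun r : line R => metric_at g pg r (const_mx 1) (const_mx 1) : R^o)
    \o (fun t => const_mx t)).
  apply: continuous_comp; first exact: const_mx_continuous.
  exact: cg.
by apply/funext => x /=; rewrite (ext0E _ (line_pt x)).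
Qed.

Lemma speed_integrable (gamma : line R -> X) (pg : plot D gamma) s : smooth1 s ->
  mu.-integrable `[0, 1] (EFin \o (fun t => speed pg (s t) * derive1 s t)).
Proof.
move=> ss; apply: continuous_integrable_segment => t.
apply: (@continuousM _ _ (speed pg \o s)).
  apply: (@continuous_comp _ _ _ s (speed pg)); first exact: smooth1_continuous.
  exact: speed_continuous.
exact/smooth1_continuous/smooth1_derive1.
Qed.

(** Allows plots in place of [smooth_from]: every plot is smooth by closure under precomposition,
    and proof irrelevance identifies the two proofs that [gamma] is a plot. *)
Lemma le_pseudodist (gamma : line R -> X) (pg : plot D gamma) :
  (pseudodist g (gamma (line_pt 0)) (gamma (line_pt 1)) <= (path_length g pg)%:E)%E.
Proof.
have sg : smooth_from D gamma by move=> m V h sh; exact: plot_comp.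
by apply: ereal_inf_lbound; exists gamma, sg; split=> //;
  rewrite (Prop_irrelevance pg (smooth_from_plot sg)).
Qed.

Lemma pseudodist_lt (x y : X) (e : R) : (pseudodist g x y < e%:E)%E ->
  exists (gamma : line R -> X) (pg : plot D gamma),
    [/\ gamma (line_pt 0) = x, gamma (line_pt 1) = y & path_length g pg < e].
Proof.
move=> /ereal_inf_lt[_ [gamma [sg [gx gy ->]]]]; rewrite lte_fin => le.
by exists gamma, (smooth_from_plot sg).
Qed.

(** Near [x0] each of the finitely many coefficients stays within 1 of its value at [x0], by
    continuity. The norm of a row is the maximum norm, so every coordinate of [v] is bounded by
    it. *)
Lemma metric_bound n (U : domain R n) (P : U -> X) (pP : plot D P) (x0 : U) :
  exists2 K : R, 0 <= K & \forall x \near sval x0, forall Ux : dset U x,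
    forall v, metric_at g pP (exist _ x Ux) v v <= K * `|v| ^+ 2.
Proof.
pose b i j (r : U) : R^o := metric_at g pP r (delta_mx 0 i) (delta_mx 0 j).
exists (\sum_i \sum_j (`|b i j x0| + 1)).
  by apply: sumr_ge0 => i _; apply: sumr_ge0 => j _; rewrite addr_ge0.
have [[_ cg] _ _] := hg pP.
have near_b : \forall x \near sval x0, forall ij : ('I_n * 'I_n)%type,
    `|ext0 (b ij.1 ij.2) x| <= `|b ij.1 ij.2 x0| + 1.
  apply: (@filter_forall _ ('I_n * 'I_n)%type
    (fun ij x => `|ext0 (b ij.1 ij.2) x| <= `|b ij.1 ij.2 x0| + 1)
    _ (nbhs_filter _)) => -[i j] /=.
  have := cg i j 0%N _ (svalP x0); rewrite /prop_for /continuous_at ext0E -/(b i j).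
  move=> /cvgrPdist_le/(_ 1 ltr01); apply: filterS => x.
  move=> H; rewrite -[X in `|X|](subrK (b i j x0)) addrC.
  by apply: le_trans (ler_normD _ _) _; rewrite lerD2l distrC.
near=> x => Ux v; rewrite metric_coord // mulr_suml; apply: ler_sum => i _.
rewrite mulr_suml; apply: ler_sum => j _.
have nv k : `|v 0 k| <= `|v|.
  by rewrite [leRHS]/Num.norm/= mx_normrE; apply/bigmax_geP; right; exists (0, k).
apply: le_trans (ler_norm _) _; rewrite mulrA mulrC !normrM expr2.
apply: ler_pM; rewrite ?mulr_ge0 //; last by rewrite ler_pM.
have E : ext0 (b i j) x = metric_at g pP _ _ _ := ext0E (b i j) (exist _ x Ux).
rewrite -E -/(b i j x0).
by have /(_ _ (i, j)) := near near_b x; apply.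
Unshelve. all: by end_near. Qed.

Lemma speed_curve n (V : domain R n) (Q : V -> X) (pQ : plot D Q)
    (gamma : line R -> X) (pg : plot D gamma) (W : domain R 1)
    (a u : 'rV[R]_n) (s : R -> R) (cV : forall x, dset W x -> dset V (curve a u s x)) :
  smooth1 s ->
  (forall (x : 'rV[R]_1) (Wx : dset W x),
     gamma (exist _ x I) = Q (exist _ (curve a u s x) (cV x Wx))) ->
  forall (t : R) (Wt : dset W (const_mx t)),
  speed pg t = `|derive1 s t| * Num.sqrt (metric_at g pQ (exist _ _ (cV _ Wt)) u u).
Proof.
move=> ss gQ t Wt.
by rewrite /speed (metric_curve hg pQ pg ss gQ Wt) sqrtrM ?sqr_ge0 // sqrtr_sqr.
Qed.

Lemma plot_curve n (V : domain R n) (Q : V -> X) (pQ : plot D Q) (W : domain R 1)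
    (a u : 'rV[R]_n) (s : R -> R) (cV : forall x, dset W x -> dset V (curve a u s x)) :
  smooth1 s -> plot D (fun x : W => Q (exist _ _ (cV _ (svalP x)))).
Proof.
move=> ss; apply: (@plot_comp _ _ _ _ _ _ _
  (fun x : W => exist _ _ (cV _ (svalP x)))) => //.
apply: (@smooth_map_ext _ _ _ _ _ _ (curve a u s)) => // k.
by apply: Ck_curve => //; exact: dset_open.
Qed.

Lemma pseudodist_plot_near n (U : domain R n) (P : U -> X) (pP : plot D P)
    (x0 : U) (e : R) :
  0 < e -> \forall x \near sval x0, forall Ux : dset U x,
    (pseudodist g (P x0) (P (exist _ x Ux)) < e%:E)%E.
Proof.
move=> e0; have [K K0 nK] := metric_bound pP x0.
have nU := dpoint_nbhs x0.
have [d /= d0 dUK] := (nbhs_ballP _ _).1 (filterI nU nK).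
(* The added 1 keeps the divisor positive when [K = 0]; a norm of [u] below [e / C] still makes [c]
   smaller than [e]. *)
pose C := Num.sqrt K + 1; have C0 : 0 < C by rewrite ltr_wpDl ?sqrtr_ge0.
have m0 : 0 < Num.min d (e / C) by rewrite lt_min d0 divr_gt0.
near=> x => Ux; pose u := x - sval x0.
have um : `|u| < Num.min d (e / C).
  by rewrite /u distrC; near: x; exact: cvgr_dist_lt.
have ud : `|u| < d by move: um; rewrite lt_min => /andP[].
have cball y : ball (sval x0) d (curve (sval x0) u (@smooth_step R) y).
  rewrite -ball_normE /= /curve opprD addNKr normrN normrZ ger0_norm ?smooth_step_ge0 //.
  by apply: le_lt_trans ud; rewrite ler_piMl // smooth_step_le1.
have cU y : dset (line R) y -> dset U (curve (sval x0) u (@smooth_step R) y).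
  by move=> _; have [] := dUK _ (cball y).
have pg := plot_curve pP cU (@smooth_step_smooth R).
have := le_pseudodist pg.
set p0 := exist _ (curve _ _ _ _) _; set p1 := exist _ (curve _ _ _ _) _.
have -> : p0 = x0.
  by apply: dpoint_inj; rewrite /= /curve !mxE smooth_step_le0 // scale0r addr0.
have -> : p1 = exist _ x Ux.
  by apply: dpoint_inj; rewrite /= /curve !mxE smooth_step_ge1 // scale1r addrC subrK.
move/le_lt_trans; apply; rewrite lte_fin.
pose c := Num.sqrt K * `|u|.
have ce : c < e.
  move: um; rewrite lt_min => /andP[_]; rewrite ltr_pdivlMr // mulrC.
  by apply: le_lt_trans; rewrite ler_wpM2r // lerDl.
have ds0 := smooth1_derive1 (@smooth_step_smooth R).
have sc t : speed pg t <= c * derive1 (@smooth_step R) t.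
  rewrite (@speed_curve _ _ _ pP _ _ (line R) _ _ _ cU
    (@smooth_step_smooth R) _ t I); last first.
    by move=> y Wy; congr P; exact: dpoint_inj.
  rewrite ger0_norm ?derive1_smooth_step_ge0 // mulrC.
  rewrite ler_wpM2r ?derive1_smooth_step_ge0 //.
  rewrite /c -[X in _ * X]ger0_norm // -sqrtr_sqr -sqrtrM // ler_wsqrtr //.
  by have [_] := dUK _ (cball (const_mx t)); apply.
(* Substitution in the constant [c]: as the step runs from 0 to 1, the bound on the speed integrates
   to exactly [c]. *)
have [F F01 /(_ _ (@smooth_step_smooth R))] :=
  integral_substitution (@cst_continuous R R c).
rewrite (smooth_step_le0 (lexx 0)) (smooth_step_ge1 (lexx 1)) F01 => Fs.
apply: le_lt_trans ce; apply: (@le_trans _ _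
  (\int[mu]_(t in `[0, 1]) (c * derive1 (@smooth_step R) t))).
  apply: le_Rintegral => //.
  - by apply: continuous_integrable_segment; exact: speed_continuous.
  - apply: continuous_integrable_segment => t.
    apply: (@continuousM _ _ (cst c)); first exact: cst_continuous.
    exact: smooth1_continuous.
  - by move=> t _; exact: sc.
have s01 t : 0 <= @smooth_step R t <= 1 by rewrite smooth_step_ge0 smooth_step_le1.
rewrite [leLHS](Fs s01).
rewrite Rintegral_cst //= lebesgue_measure_itv /= lte_fin ltr01 oppr0 adde0 /= mulr1.
by [].
Unshelve. all: by end_near. Qed.

(** A constant plot sends every nearby point to [x], the base point included. *)
Lemma pseudodist_refl x (e : R) : 0 < e -> (pseudodist g x x < e%:E)%E.
Proof.
move=> e0; pose r : line R := line_pt 0.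
have := pseudodist_plot_near (plot_cst D (line R) x) r e0.
by move=> /nbhs_singleton/(_ I).
Qed.

(** * Reparametrization and symmetry *)

Section reparametrization.
Variables (gamma rho : line R -> X) (pg : plot D gamma) (pr : plot D rho).

(** Here [gamma] itself is the plot that [rho] follows, along the curve from 0 in direction 1. The
    relation is asked on [W] only, so that it applies to each half of a glued path. *)
Lemma speed_reparam (W : domain R 1) (s : R -> R) : smooth1 s ->
  (forall t : R, dset W (const_mx t) -> rho (line_pt t) = gamma (line_pt (s t))) ->
  forall t : R, dset W (const_mx t) -> speed pr t = `|derive1 s t| * speed pg (s t).
Proof.
move=> ss rg t Wt.
have cl (x : 'rV[R]_1) : dset W x -> dset (line R) (curve 0 (const_mx 1) s x) by [].
have cE (t' : R) : curve 0 (const_mx 1) s (const_mx t') = const_mx (s t').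
  by apply/matrixP => i j; rewrite !mxE add0r mulr1.
rewrite (@speed_curve _ _ _ pg _ pr W 0 (const_mx 1) s cl ss _ t Wt).
  congr (_ * Num.sqrt (metric_at g pg _ _ _)); apply: dpoint_inj; exact: cE.
move=> x Wx; have xE : x = const_mx (x 0 0).
  by apply/matrixP => i j; rewrite mxE !ord1.
transitivity (rho (line_pt (x 0 0))); first by congr rho; apply: dpoint_inj.
rewrite rg -?xE //; congr gamma; apply: dpoint_inj => /=.
by rewrite {2}xE cE.
Qed.

End reparametrization.

(** Strict bounds avoid any attained infimum: it is enough to reverse a single path. The reversal
    goes through [smooth_step] because [integral_substitution] wants values in [0, 1] at all real
    parameters, which [1 - t] does not have. *)
Lemma pseudodist_sym_lt x y (e : R) :
  (pseudodist g x y < e%:E)%E -> (pseudodist g y x < e%:E)%E.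
Proof.
move=> /pseudodist_lt[gamma [pg [<- <- le]]].
pose s (t : R) := 1 - smooth_step t.
have ss : smooth1 s := smooth1_1B (@smooth_step_smooth R).
have cl (z : 'rV[R]_1) :
  dset (line R) z -> dset (line R) (curve 0 (const_mx 1) s z) by [].
have pr := plot_curve pg cl ss.
have cE (t : R) : gamma (exist _ _ (cl _ (svalP (line_pt t)))) = gamma (line_pt (s t)).
  by congr gamma; apply: dpoint_inj; apply/matrixP => i j; rewrite !mxE add0r mulr1.
have s0 : s 0 = 1 by rewrite /s smooth_step_le0 // subr0.
have s1 : s 1 = 0 by rewrite /s smooth_step_ge1 // subrr.
have := le_pseudodist pr; rewrite !cE s0 s1.
move=> /le_lt_trans; apply; rewrite lte_fin; apply: le_lt_trans le.
have [F F01 /(_ _ ss) Fs] := integral_substitution (@speed_continuous _ pg).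
have s01 t : 0 <= s t <= 1 by rewrite subr_ge0 smooth_step_le1 gerBl smooth_step_ge0.
have {}Fs := Fs s01; rewrite s0 s1 in Fs.
rewrite le_eqVlt; apply/orP; left; apply/eqP.
(* [s] decreases, so the absolute value of its derivative brings a sign, which makes up for the
   exchanged endpoints. *)
transitivity (\int[mu]_(t in `[0, 1]) (-1 * (speed pg (s t) * derive1 s t))).
  apply: eq_Rintegral => t _.
  rewrite -/(speed pr t) (@speed_reparam _ _ pg pr (line R) s ss (fun z _ => cE z) t I).
  rewrite /s derive1_1B; last exact: smooth_step_smooth.
  by rewrite normrN ger0_norm ?derive1_smooth_step_ge0 // mulN1r mulrN opprK mulrC.
rewrite RintegralZl //; last exact: speed_integrable.
by rewrite Fs mulN1r opprB.
Qed.

(** * Concatenation of paths and the triangle inequality *)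

Section concatenation.
Variables (gamma1 gamma2 : line R -> X) (pg1 : plot D gamma1) (pg2 : plot D gamma2).
Hypothesis g12 : gamma1 (line_pt 1) = gamma2 (line_pt 0).

(* On [1/3, 2/3], where the two halves overlap, s1 = 1 and s2 = 0. *)
Let s1 (t : R) := @smooth_step R (3 * t + 0).
Let s2 (t : R) := @smooth_step R (3 * t + (-2)).

Let ss1 : smooth1 s1 := smooth1_comp (@smooth_step_smooth R) (smooth1_affine 3 0).
Let ss2 : smooth1 s2 := smooth1_comp (@smooth_step_smooth R) (smooth1_affine 3 (-2)).

Definition path_cat (p : line R) : X :=
  if sval p 0 0 <= 1/2 then gamma1 (line_pt (s1 (sval p 0 0)))
  else gamma2 (line_pt (s2 (sval p 0 0))).

(** Beyond 1/2 the definition has switched to [gamma2], but there both halves rest at the common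
    endpoint given by [g12]. With the next lemma, each formula thus holds on an open set, as
    locality requires. *)
Lemma path_cat1 t : t < 2/3 -> path_cat (line_pt t) = gamma1 (line_pt (s1 t)).
Proof.
move=> t23; rewrite /path_cat/= mxE; case: ifPn => //; rewrite -ltNge => t12.
have -> : s1 t = 1 by apply: smooth_step_ge1; lra.
by have -> : s2 t = 0 by apply: smooth_step_le0; lra.
Qed.

Lemma path_cat2 t : 1/3 < t -> path_cat (line_pt t) = gamma2 (line_pt (s2 t)).
Proof.
move=> t13; rewrite /path_cat/= mxE; case: ifPn => // t12.
have -> : s1 t = 1 by apply: smooth_step_ge1; lra.
by have -> : s2 t = 0 by apply: smooth_step_le0; lra.
Qed.

Lemma coord_open (A : set R) : open A -> open [set x : 'rV[R]_1 | A (x 0 0)].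
Proof. by move=> oA; apply: open_comp => // x _; exact: coord_continuous. Qed.

Let halves (b : bool) : domain R 1 :=
  if b then Domain (coord_open (@open_lt _ (2/3 : R)))
  else Domain (coord_open (@open_gt _ (1/3 : R))).

(** By locality only the two open halves matter, and on each of them the path is a plot after one
    smooth curve. *)
Lemma plot_path_cat : plot D path_cat.
Proof.
have sub b : dset (halves b) `<=` dset (line R) by [].
apply: (@plot_local _ _ D _ _ _ bool halves sub).
  apply/seteqP; split=> // x _.
  by have [?|?] := ltP (x 0 0) (2/3); [exists true | exists false] => //=; lra.
have cl (b : bool) s (z : 'rV[R]_1) :
  dset (halves b) z -> dset (line R) (curve 0 (const_mx 1) s z) by [].
have E (Q : line R -> X) (s : R -> R) (z : 'rV[R]_1)
    (l : dset (line R) (curve 0 (const_mx 1) s z)) :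
    Q (exist _ _ l) = Q (line_pt (s (z 0 0))).
  by congr Q; apply: dpoint_inj; apply/matrixP => i j; rewrite !mxE add0r mulr1.
have Eline (z : 'rV[R]_1) (l : dset (line R) z) : exist _ z l = line_pt (z 0 0).
  by apply: (@dpoint_inj _ _ (line R)); apply/matrixP => i j; rewrite mxE !ord1.
have E1 : path_cat \o dincl (sub true) =
    (fun z : halves true => gamma1 (exist _ _ (cl true s1 _ (svalP z)))).
  by apply/funext => -[z Wz]; rewrite E /= /dincl/= Eline path_cat1.
have E2 : path_cat \o dincl (sub false) =
    (fun z : halves false => gamma2 (exist _ _ (cl false s2 _ (svalP z)))).
  by apply/funext => -[z Wz]; rewrite E /= /dincl/= Eline path_cat2.
case; first by rewrite E1; refine (plot_curve pg1 (cl true s1) ss1).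
by rewrite E2; refine (plot_curve pg2 (cl false s2) ss2).
Qed.

(** The derivative of [s2] vanishes up to 1/2 and that of [s1] afterwards, so the sum is the speed
    of the active half. Additivity of length then needs no splitting of the interval. *)
Lemma speed_path_cat t : speed plot_path_cat t =
  speed pg1 (s1 t) * derive1 s1 t + speed pg2 (s2 t) * derive1 s2 t.
Proof.
have late : t <= 1/2 -> [/\ 3 * t + (-2) < 0, t < 2/3 & 0 <= 3 :> R] by split; lra.
have early : 1/2 < t -> [/\ 1 < 3 * t + 0, 1/3 < t & 0 <= 3 :> R] by split; lra.
have d1 : derive1 s1 t = 3 * derive1 (@smooth_step R) (3 * t + 0).
  exact: derive1_comp_affine 3 0 t (@smooth_step_smooth R).
have d2 : derive1 s2 t = 3 * derive1 (@smooth_step R) (3 * t + (-2)).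
  exact: derive1_comp_affine 3 (-2) t (@smooth_step_smooth R).
have [/late[t0 t23 ge3]|/early[t0 t13 ge3]] := leP t (1/2).
  rewrite d2 derive1_smooth_step0 // !mulr0 addr0.
  have Wt : dset (halves true) (const_mx t) by rewrite /= mxE.
  rewrite (@speed_reparam _ _ pg1 plot_path_cat (halves true) _ ss1) //; last first.
    by move=> z; rewrite /= mxE; exact: path_cat1.
  by rewrite d1 ger0_norm 1?mulrC // mulr_ge0 ?derive1_smooth_step_ge0.
rewrite d1 derive1_smooth_step1 // !mulr0 add0r.
have Wt : dset (halves false) (const_mx t) by rewrite /= mxE.
rewrite (@speed_reparam _ _ pg2 plot_path_cat (halves false) _ ss2) //; last first.
  by move=> z; rewrite /= mxE; exact: path_cat2.
by rewrite d2 ger0_norm 1?mulrC // mulr_ge0 ?derive1_smooth_step_ge0.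
Qed.

Lemma path_length_cat :
  path_length g plot_path_cat = path_length g pg1 + path_length g pg2.
Proof.
have -> : path_length g plot_path_cat = \int[mu]_(t in `[0, 1])
    (speed pg1 (s1 t) * derive1 s1 t + speed pg2 (s2 t) * derive1 s2 t).
  by apply: eq_Rintegral => t _; exact: speed_path_cat.
rewrite RintegralD //; [|exact: speed_integrable|exact: speed_integrable].
(* Each of [s1] and [s2] already goes from 0 to 1 over the whole of [0, 1], so each term gives a
   full length. *)
have sub (gamma : line R -> X) (pg : plot D gamma) s : smooth1 s ->
    (forall t, 0 <= s t <= 1) -> s 0 = 0 -> s 1 = 1 ->
    \int[mu]_(t in `[0, 1]) (speed pg (s t) * derive1 s t) =
    \int[mu]_(t in `[0, 1]) speed pg t.
  move=> ss s01 e0 e1.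
  have [F <- /(_ _ ss s01)] := integral_substitution (@speed_continuous _ pg).
  by rewrite e0 e1.
congr (_ + _); apply: sub => //.
- by move=> t; rewrite smooth_step_ge0 smooth_step_le1.
- by apply: smooth_step_le0; lra.
- by apply: smooth_step_ge1; lra.
- by move=> t; rewrite smooth_step_ge0 smooth_step_le1.
- by apply: smooth_step_le0; lra.
- by apply: smooth_step_ge1; lra.
Qed.

Lemma path_cat_ends : path_cat (line_pt 0) = gamma1 (line_pt 0) /\
  path_cat (line_pt 1) = gamma2 (line_pt 1).
Proof.
split.
  rewrite path_cat1; last by lra.
  by have -> : s1 0 = 0 by apply: smooth_step_le0; lra.
rewrite path_cat2; last by lra.
by have -> : s2 1 = 1 by apply: smooth_step_ge1; lra.
Qed.

End concatenation.

(** Strict bounds provide actual paths to concatenate, and lengths add up. *)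
Lemma pseudodist_triangle_lt x y z (a b : R) : (pseudodist g x y < a%:E)%E ->
  (pseudodist g y z < b%:E)%E -> (pseudodist g x z < (a + b)%:E)%E.
Proof.
move=> /pseudodist_lt[gamma1 [pg1 [<- gy lt1]]] /pseudodist_lt[gamma2 [pg2 [gy' <- lt2]]].
rewrite -gy' in gy.
have := le_pseudodist (plot_path_cat pg1 pg2 gy).
have [-> ->] := path_cat_ends gy; rewrite path_length_cat.
by move=> /le_lt_trans; apply; rewrite lte_fin ltrD.
Qed.

(** * Comparison of the topologies and continuity *)

Lemma pdist_open_D_open (V : set X) : pdist_open (pseudodist g) V -> D_open D V.
Proof.
move=> oV n U P pP; rewrite openE => x0 [Ux0 Vx0] /=.
have [e e0 eV] := oV _ Vx0.
have nU : nbhs x0 (dset U) by apply: open_nbhs_nbhs; split=> //; exact: dset_open.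
apply: filterS (filterI nU (pseudodist_plot_near pP (exist _ x0 Ux0) e0)).
by move=> x [Ux dx]; exists Ux; exact/eV/dx.
Qed.

(** The triangle inequality makes balls open for the pseudodistance, hence open in the
    D-topology. *)
Lemma pseudodist_ball_nbhs (x : dspace D) (e : R) : 0 < e ->
  nbhs x [set y : dspace D | (pseudodist g x y < e%:E)%E].
Proof.
move=> e0; apply: open_nbhs_nbhs; split; last exact: pseudodist_refl.
apply: pdist_open_D_open => y /= xy.
have xyf : pseudodist g x y \is a fin_num.
  by rewrite ge0_fin_numE ?pseudodist_ge0 // (lt_trans xy) ?ltry.
move: xy; rewrite -(fineK xyf) lte_fin => xy.
(* Half of the gap is the radius around [y]; the other half is the slack for a strict bound on the
   distance from [x] to [y]. *)
have h : 0 < (e - fine (pseudodist g x y)) / 2 by rewrite divr_gt0 ?subr_gt0.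
exists ((e - fine (pseudodist g x y)) / 2) => // z yz /=.
have xy' : (pseudodist g x y < ((e + fine (pseudodist g x y)) / 2)%:E)%E.
  by rewrite -[ltLHS](fineK xyf) lte_fin; lra.
by have := pseudodist_triangle_lt xy' yz; rewrite -mulrDl; congr (_ < _%:E)%E; lra.
Qed.

End pseudodistance.

Theorem theorem3p21 (R : realType) (X : Type) (D : diffeology R X)
    (cX : diff_connected D) (g : T2 D -> R) (hg : weak_riemannian_metric g) :
  (forall V : set (dspace D), pdist_open (pseudodist g) V -> open V) /\
  continuous (fun p : dspace D * dspace D => fine (pseudodist g p.1 p.2) : R).
Proof.
split=> [V|[x y]]; first exact: pdist_open_D_open.
pose d x y := fine (pseudodist g x y).
(* Connectedness makes all distances finite, so [fine] loses nothing. *)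
have dlt x' y' (e : R) : (pseudodist g x' y' < e%:E)%E = (d x' y' < e).
  by rewrite -[in LHS](fineK (pseudodist_fin_num g x' y' cX)) lte_fin.
have sym x' y' e : d x' y' < e -> d y' x' < e by rewrite -!dlt; exact: pseudodist_sym_lt.
have tri x' y' z' a b : d x' y' < a -> d y' z' < b -> d x' z' < a + b.
  by rewrite -!dlt; exact: pseudodist_triangle_lt.
apply/cvgrPdist_lt => e e0 /=.
(* Each estimate spends three quarters of [e]: one for each moved endpoint, and one for the slack
   [dd] that turns the middle distance into a strict bound. *)
have e4 : 0 < e / 4 by rewrite divr_gt0.
exists ([set x' | pseudodist g x x' < (e / 4)%:E],
  [set y' | pseudodist g y y' < (e / 4)%:E])%E.
  by split; exact: pseudodist_ball_nbhs.
move=> [x' y'] [/=]; rewrite !dlt -/(d x y) -/(d x' y') => xx' yy'.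
have dd u v : d u v < d u v + e / 4 by rewrite ltrDl.
have H1 := tri _ _ _ _ _ (sym _ _ _ xx') (tri _ _ _ _ _ (dd x y) yy').
have H2 := tri _ _ _ _ _ xx' (tri _ _ _ _ _ (dd x' y') (sym _ _ _ yy')).
by rewrite ltr_norml; apply/andP; split; lra.
Qed.
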